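(* For $\alpha_1,\alpha_2\in\mathbb{N}_0$, $\lambda,\eta,\delta\in\mathbb{C}$ and $n\in\mathbb{N}$, the following relation holds: $${}_{\mathfrak{B}}\mathcal{F}_n^{(\alpha_1+\alpha_2)}(x_1+x_2,y_1+y_2;\lambda;\eta,\delta)=\sum_{k=0}^{n}\binom{n}{k}\,{}_{\mathfrak{B}}\mathcal{F}_k^{(\alpha_1)}(x_1,y_1;\lambda;\eta,\delta)\;{}_{\mathfrak{B}}\mathcal{F}_{n-k}^{(\alpha_2)}(x_2,y_2;\lambda;\eta,\delta).$$
   Context: $\mathbb{N}$ is the set of natural numbers, $\mathbb{N}_0$ the set of non-negative integers, $\mathbb{C}$ the set of complex numbers; $x_1,x_2,y_1,y_2$ are variables. For $\alpha\in\mathbb{N}_0$ and $\lambda,\eta,\delta\in\mathbb{C}$, the Bell based Apostol type polynomials ${}_{\mathfrak{B}}\mathcal{F}_n^{(\alpha)}(x,y;\lambda;\eta,\delta)$ of order $\alpha$ are defined by the generating function $$\sum_{n\ge 0}{}_{\mathfrak{B}}\mathcal{F}_n^{(\alpha)}(x,y;\lambda;\eta,\delta)\frac{t^n}{n!}=\left(\frac{2^{\eta}t^{\delta}}{\lambda e^{t}+1}\right)^{\alpha}e^{xt+y(e^t-1)},\qquad |t|<|\log(-\lambda)|.$$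
   Formalization: The polynomials of orders α₁ and α₂ are assumed to exist, i.e. their generating functions are power series in t (this fails e.g. for δ=1/2, α₁=1); for λ=−1, where |t|<|log(−λ)| is empty, the disc |t|<2π is used, and for λ=0 the whole plane. *)

(* Defs.v *)
From Stdlib Require Import Reals Arith.Factorial ClassicalEpsilon.
From Coquelicot Require Import Coquelicot.

Open Scope C_scope.

Definition Cexp (z : C) : C :=
  RtoC (exp (Re z)) * (cos (Im z), sin (Im z)).

(* Principal argument, with values in (-PI, PI] for z <> 0. *)
Definition Carg (z : C) : R :=
  if Rle_dec 0 (Im z) then acos (Re z / Cmod z)
  else Ropp (acos (Re z / Cmod z)).

(* Principal logarithm; the value at 0 is meaningless. *)
Definition Clog (z : C) : C := (ln (Cmod z), Carg z).

(* Principal power z^w; used only for z <> 0. *)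
Definition Cpower (z w : C) : C := Cexp (w * Clog z).

Definition bell_apostol_gf (alpha : nat) (lambda eta delta x y t : C) : C :=
  (Cpower (RtoC 2) eta * Cpower t delta / (lambda * Cexp t + 1)) ^ alpha
  * Cexp (x * t + y * (Cexp t - 1)).

(* |log (- lambda)|, the distance from 0 to the nearest zero of
   t |-> lambda e^t + 1. There is no zero when lambda = 0. When lambda = -1
   (Bernoulli type), t = 0 is itself a zero, to be cancelled by t^delta, and the
   usual convention for Apostol type polynomials is |t| < 2 pi; the literal
   value |log 1| = 0 would leave no t at all. *)
Definition bell_apostol_radius (lambda : C) : Rbar :=
  if Ceq_dec lambda (RtoC 0) then p_infty
  else if Ceq_dec lambda (RtoC (-1)) then Finite (2 * PI)
  else Finite (Cmod (Clog (- lambda))).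

(* The value at t = 0, where t^delta and (for lambda = -1) the quotient are to
   be read by continuity, is determined by the values at t <> 0. *)
Definition is_bell_apostol (alpha : nat) (lambda eta delta x y : C)
    (F : nat -> C) : Prop :=
  forall t : C, t <> RtoC 0 ->
    Rbar_lt (Finite (Cmod t)) (bell_apostol_radius lambda) ->
    @is_series C_AbsRing C_NormedModule
      (fun n : nat => F n * (t ^ n / RtoC (INR (fact n))))
      (bell_apostol_gf alpha lambda eta delta x y t).

(* For arbitrary complex delta the right-hand side of the generating relation
   need not be a power series in t (e.g. alpha = 1, delta = 1/2). *)
Definition ex_bell_apostol (alpha : nat) (lambda eta delta x y : C) : Prop :=
  exists F : nat -> C, is_bell_apostol alpha lambda eta delta x y F.

(* The n-th polynomial of order alpha, evaluated at (x, y); meaningful when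
   [ex_bell_apostol] holds, as coefficients of a power series are unique. *)
Definition bell_apostol (alpha n : nat) (x y lambda eta delta : C) : C :=
  epsilon (inhabits (fun _ : nat => RtoC 0))
    (is_bell_apostol alpha lambda eta delta x y) n.

(* Main.v *)
Require Import Defs.
From Stdlib Require Import Reals Arith.Factorial Lra Lia ClassicalEpsilon.
From Coquelicot Require Import Coquelicot.

Open Scope C_scope.

(** The generating function is multiplicative in its parameters: raising the
    common quotient to the power [alpha1 + alpha2] and adding the exponents
    [x t + y (e^t - 1)] gives the product of the two generating functions
    ([bell_apostol_gf_mult]). Inside the disc of the generating relation both
    expansions converge absolutely, so their Cauchy product converges to that
    product, and its coefficients are the binomial convolutions
    ([is_bell_apostol_convolution]). The convolution sequence thus satisfies the
    relation that characterizes the polynomials of order [alpha1 + alpha2], and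
    uniqueness of power series coefficients ([is_bell_apostol_unique]) identifies
    the two; this needs the disc to have positive radius
    ([bell_apostol_radius_gt_0]).

    Complex power series are reduced to real ones through real and imaginary
    parts. Convergence at a real point [r] bounds the two real radii of
    convergence from below, which gives absolute convergence at every complex
    [t] with [|t| < r]; for uniqueness real values of [t] suffice. *)

(** * Complex series *)

(** Convergence of a series of complex numbers in the complex plane seen as a
    normed module over itself. *)
Definition is_seriesC : (nat -> C) -> C -> Prop :=
  @is_series C_AbsRing C_NormedModule.

Lemma Re_sum_n (a : nat -> C) (n : nat) :
  Re (sum_n a n) = sum_n (fun k => Re (a k)) n.
Proof.
  induction n as [|n IH].
  - now rewrite !sum_O.
  - now rewrite !sum_Sn, <- IH.
Qed.

Lemma Im_sum_n (a : nat -> C) (n : nat) :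
  Im (sum_n a n) = sum_n (fun k => Im (a k)) n.
Proof.
  induction n as [|n IH].
  - now rewrite !sum_O.
  - now rewrite !sum_Sn, <- IH.
Qed.

Lemma is_seriesC_components (a : nat -> C) (l : C) :
  is_seriesC a l <->
  is_series (fun n => Re (a n)) (Re l) /\ is_series (fun n => Im (a n)) (Im l).
Proof.
  unfold is_seriesC, is_series. split.
  - intros H; split.
    + apply filterlim_ext with (fun n => Re (sum_n a n)).
      { intros n; apply Re_sum_n. }
      apply filterlim_locally. intros eps.
      generalize (proj1 (filterlim_locally _ _) H eps).
      apply filter_imp. intros n Hn; exact (proj1 Hn).
    + apply filterlim_ext with (fun n => Im (sum_n a n)).
      { intros n; apply Im_sum_n. }
      apply filterlim_locally. intros eps.
      generalize (proj1 (filterlim_locally _ _) H eps).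
      apply filter_imp. intros n Hn; exact (proj2 Hn).
  - intros [Hre Him].
    apply filterlim_locally. intros eps.
    generalize (filter_and _ _ (proj1 (filterlim_locally _ _) Hre eps)
                  (proj1 (filterlim_locally _ _) Him eps)).
    apply filter_imp. intros n [H1 H2].
    rewrite <- Re_sum_n in H1; rewrite <- Im_sum_n in H2.
    split; assumption.
Qed.

Lemma ex_series_Rabs_Re (a : nat -> C) :
  ex_series (fun n => Cmod (a n)) -> ex_series (fun n => Rabs (Re (a n))).
Proof.
  apply @ex_series_le. intros n. unfold norm; simpl; unfold abs; simpl.
  rewrite Rabs_Rabsolu. eapply Rle_trans; [apply Rmax_l | apply Rmax_Cmod].
Qed.

Lemma ex_series_Rabs_Im (a : nat -> C) :
  ex_series (fun n => Cmod (a n)) -> ex_series (fun n => Rabs (Im (a n))).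
Proof.
  apply @ex_series_le. intros n. unfold norm; simpl; unfold abs; simpl.
  rewrite Rabs_Rabsolu. eapply Rle_trans; [apply Rmax_r | apply Rmax_Cmod].
Qed.

(** Cauchy product, from the four real products of the components. *)
Lemma is_seriesC_mult (a b : nat -> C) (la lb : C) :
  is_seriesC a la -> is_seriesC b lb ->
  ex_series (fun n => Cmod (a n)) -> ex_series (fun n => Cmod (b n)) ->
  is_seriesC (fun n => sum_n (fun k => a k * b (n - k)%nat) n) (la * lb).
Proof.
  intros Ha Hb Aa Ab.
  apply is_seriesC_components in Ha; destruct Ha as [Har Hai].
  apply is_seriesC_components in Hb; destruct Hb as [Hbr Hbi].
  pose proof (ex_series_Rabs_Re a Aa) as Aar.
  pose proof (ex_series_Rabs_Im a Aa) as Aai.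
  pose proof (ex_series_Rabs_Re b Ab) as Abr.
  pose proof (ex_series_Rabs_Im b Ab) as Abi.
  apply is_seriesC_components; split.
  - rewrite re_mult.
    eapply is_series_ext;
      [| exact (is_series_minus _ _ _ _ (is_series_mult _ _ _ _ Har Hbr Aar Abr)
                  (is_series_mult _ _ _ _ Hai Hbi Aai Abi))].
    intros n; cbv beta. rewrite Re_sum_n.
    change (plus ?u (opp ?v)) with (u - v)%R.
    rewrite !sum_n_Reals, <- minus_sum.
    apply sum_eq. intros k _. now rewrite re_mult.
  - rewrite im_mult.
    eapply is_series_ext;
      [| exact (is_series_plus _ _ _ _ (is_series_mult _ _ _ _ Har Hbi Aar Abi)
                  (is_series_mult _ _ _ _ Hai Hbr Aai Abr))].
    intros n; cbv beta. rewrite Im_sum_n.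
    change (plus ?u ?v) with (u + v)%R.
    rewrite !sum_n_Reals, <- plus_sum.
    apply sum_eq. intros k _. now rewrite im_mult.
Qed.

(** * Complex power series *)

Lemma CV_radius_ge_of_ex_series (a : nat -> R) (r : R) :
  (0 <= r)%R -> ex_series (fun n => a n * r ^ n)%R ->
  Rbar_le (Finite r) (CV_radius a).
Proof.
  intros Hr Hex. apply Rbar_not_lt_le. intros Hlt.
  apply (CV_disk_outside a r).
  - now rewrite Rabs_pos_eq.
  - now apply ex_series_lim_0.
Qed.

Lemma is_seriesC_real_point (c : nat -> C) (x : R) (l : C) :
  is_seriesC (fun n => c n * RtoC x ^ n) l ->
  is_series (fun n => Re (c n) * x ^ n)%R (Re l) /\
  is_series (fun n => Im (c n) * x ^ n)%R (Im l).
Proof.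
  intros H. apply is_seriesC_components in H. destruct H as [Hr Hi].
  split; (eapply is_series_ext; [| eassumption]); intros n; simpl;
    rewrite <- RtoC_pow; simpl.
  - apply re_scal_r.
  - apply im_scal_r.
Qed.

(** A complex power series that converges at a real point [r] converges
    absolutely in the open disc of radius [r]: the two real power series of its
    components have radius of convergence at least [r]. *)
Lemma ex_series_Cmod_inside (c : nat -> C) (r : R) (l t : C) :
  is_seriesC (fun n => c n * RtoC r ^ n) l -> (Cmod t < r)%R ->
  ex_series (fun n => Cmod (c n * t ^ n)).
Proof.
  intros H Ht. pose proof (Cmod_ge_0 t) as Ht0.
  destruct (is_seriesC_real_point c r l H) as [Hr Hi].
  assert (inside : forall a : nat -> R, ex_series (fun n => a n * r ^ n)%R ->
            ex_series (fun n => Rabs (a n * Cmod t ^ n))).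
  { intros a Ha. apply CV_disk_inside. rewrite Rabs_pos_eq by assumption.
    apply Rbar_lt_le_trans with (Finite r); [exact Ht|].
    apply CV_radius_ge_of_ex_series; [lra | exact Ha]. }
  pose proof (inside _ (ex_intro _ _ Hr)) as Ar.
  pose proof (inside _ (ex_intro _ _ Hi)) as Ai.
  eapply @ex_series_le; [| exact (ex_series_plus _ _ Ar Ai)].
  intros n. unfold norm; simpl; unfold abs; simpl.
  rewrite Rabs_pos_eq by apply Cmod_ge_0.
  change (plus ?u ?v) with (u + v)%R.
  rewrite Cmod_mult, Cmod_pow, !Rabs_mult.
  rewrite (Rabs_pos_eq (Cmod t ^ n)) by now apply pow_le.
  rewrite <- Rmult_plus_distr_r. apply Rmult_le_compat_r; [now apply pow_le|].
  rewrite (surjective_pairing (c n)) at 1.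
  replace (fst (c n), snd (c n)) with (RtoC (Re (c n)) + Ci * RtoC (Im (c n))).
  - eapply Rle_trans; [apply Cmod_triangle|].
    rewrite Cmod_mult, Cmod_Ci, !Cmod_R. lra.
  - unfold Ci, RtoC, Cplus, Cmult, Re, Im; simpl; f_equal; ring.
Qed.

(** Agreement is assumed only for [x] different from 0; both sums are continuous
    at 0, so it extends to 0 itself. *)
Lemma pseries_coef_unique (a b : nat -> R) (r : R) :
  (0 < r)%R ->
  (forall x : R, (0 < Rabs x < r)%R ->
     exists l : R, is_series (fun n => a n * x ^ n)%R l /\
                   is_series (fun n => b n * x ^ n)%R l) ->
  forall n, a n = b n.
Proof.
  intros Hr H n.
  assert (Heq : forall x : R, (0 < Rabs x < r)%R -> PSeries a x = PSeries b x).
  { intros x Hx. destruct (H x Hx) as [l [Ha Hb]].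
    rewrite (is_pseries_unique a x l) by now apply is_pseries_R.
    symmetry. apply is_pseries_unique. now apply is_pseries_R. }
  assert (Hh : (0 < Rabs (r / 2) < r)%R) by (rewrite Rabs_pos_eq; lra).
  destruct (H _ Hh) as [l [Ha Hb]].
  assert (Hra : Rbar_lt (Finite 0) (CV_radius a)).
  { apply Rbar_lt_le_trans with (Finite (r / 2)); [simpl; lra|].
    apply CV_radius_ge_of_ex_series; [lra | now exists l]. }
  assert (Hrb : Rbar_lt (Finite 0) (CV_radius b)).
  { apply Rbar_lt_le_trans with (Finite (r / 2)); [simpl; lra|].
    apply CV_radius_ge_of_ex_series; [lra | now exists l]. }
  apply PSeries_ext_recip; [assumption | assumption |].
  assert (Hpunct : locally' (0 : R) (fun x : R => PSeries a x = PSeries b x)).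
  { exists (mkposreal r Hr). intros x Hx Hx0. apply Heq.
    unfold ball in Hx; simpl in Hx; unfold AbsRing_ball, abs, minus, plus, opp in Hx;
      simpl in Hx.
    rewrite Ropp_0, Rplus_0_r in Hx. split; [now apply Rabs_pos_lt | exact Hx]. }
  assert (lim0 : forall c : nat -> R, Rbar_lt (Finite 0) (CV_radius c) ->
            is_lim (PSeries c) (Finite 0) (Finite (PSeries c 0))).
  { intros c Hc. apply is_lim_continuity, PSeries_continuity.
    now rewrite Rabs_R0. }
  assert (H0 : PSeries a 0 = PSeries b 0).
  { assert (E : Finite (PSeries a 0) = Finite (PSeries b 0)).
    { rewrite <- (is_lim_unique _ _ _ (lim0 a Hra)).
      rewrite <- (is_lim_unique _ _ _ (lim0 b Hrb)).
      symmetry. apply Lim_ext_loc. exact Hpunct. }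
    now injection E. }
  destruct Hpunct as [d Hd]. exists d. intros x Hx.
  destruct (Req_dec x 0) as [-> | Hx0]; [exact H0 | now apply Hd].
Qed.

Lemma pseriesC_coef_unique (c d : nat -> C) (r : R) :
  (0 < r)%R ->
  (forall x : R, (0 < Rabs x < r)%R ->
     exists l : C, is_seriesC (fun n => c n * RtoC x ^ n) l /\
                   is_seriesC (fun n => d n * RtoC x ^ n) l) ->
  forall n, c n = d n.
Proof.
  intros Hr H n.
  rewrite (surjective_pairing (c n)), (surjective_pairing (d n)). f_equal.
  - apply (pseries_coef_unique (fun k => Re (c k)) (fun k => Re (d k)) r Hr).
    intros x Hx. destruct (H x Hx) as [l [Hc Hd]]. exists (Re l).
    split; now apply is_seriesC_real_point.
  - apply (pseries_coef_unique (fun k => Im (c k)) (fun k => Im (d k)) r Hr).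
    intros x Hx. destruct (H x Hx) as [l [Hc Hd]]. exists (Im l).
    split; now apply is_seriesC_real_point.
Qed.

(** * The generating function *)

Lemma Cexp_add (z w : C) : Cexp (z + w) = Cexp z * Cexp w.
Proof.
  unfold Cexp. rewrite re_plus, im_plus, exp_plus, cos_plus, sin_plus.
  unfold RtoC, Cmult; simpl. f_equal; ring.
Qed.

Lemma bell_apostol_gf_mult (alpha1 alpha2 : nat)
    (lambda eta delta x1 x2 y1 y2 t : C) :
  bell_apostol_gf (alpha1 + alpha2) lambda eta delta (x1 + x2) (y1 + y2) t =
  bell_apostol_gf alpha1 lambda eta delta x1 y1 t
  * bell_apostol_gf alpha2 lambda eta delta x2 y2 t.
Proof.
  unfold bell_apostol_gf. rewrite Cpow_add_r.
  replace ((x1 + x2) * t + (y1 + y2) * (Cexp t - 1))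
    with ((x1 * t + y1 * (Cexp t - 1)) + (x2 * t + y2 * (Cexp t - 1))) by ring.
  rewrite Cexp_add. ring.
Qed.

(** The principal logarithm vanishes only at 1. *)
Lemma Clog_eq_0 (z : C) : z <> RtoC 0 -> Clog z = RtoC 0 -> z = RtoC 1.
Proof.
  intros Hz H. unfold Clog, RtoC in H. injection H as Hln Harg.
  pose proof (proj1 (Cmod_gt_0 z) Hz) as Hpos.
  assert (Hmod : Cmod z = 1%R) by (apply ln_inv; [assumption | lra | now rewrite ln_1]).
  assert (Hacos : acos (Re z) = 0%R).
  { unfold Carg in Harg. rewrite Hmod, Rdiv_1_r in Harg.
    destruct (Rle_dec 0 (Im z)); lra. }
  assert (Hbound : (-1 <= Re z <= 1)%R).
  { assert (Rabs (Re z) <= 1)%R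
      by (rewrite <- Hmod; eapply Rle_trans; [apply Rmax_l | apply Rmax_Cmod]).
    apply Rabs_le_between in H. lra. }
  (* As |z| = 1, the cosine of the argument is Re z. *)
  assert (Hre : Re z = 1%R) by (rewrite <- (cos_acos (Re z)), Hacos by assumption; apply cos_0).
  assert (Him : Im z = 0%R).
  { pose proof (Cmod2_alt z) as E. rewrite Hmod, Hre in E. nra. }
  rewrite (surjective_pairing z). unfold Re, Im in *. now rewrite Hre, Him.
Qed.

Lemma bell_apostol_radius_gt_0 (lambda : C) :
  Rbar_lt (Finite 0) (bell_apostol_radius lambda).
Proof.
  unfold bell_apostol_radius.
  destruct (Ceq_dec lambda (RtoC 0)) as [H0 | H0]; [exact I|].
  destruct (Ceq_dec lambda (RtoC (-1))) as [H1 | H1].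
  - simpl. pose proof PI_RGT_0. lra.
  - simpl. apply Cmod_gt_0. intros Hlog. apply H1.
    apply Clog_eq_0 in Hlog.
    + replace lambda with (- - lambda) by ring. rewrite Hlog. now rewrite <- RtoC_opp.
    + intros E. apply H0. replace lambda with (- - lambda) by ring. rewrite E.
      rewrite <- RtoC_opp. f_equal; ring.
Qed.

Lemma Rbar_lt_dense (x : R) (rho : Rbar) :
  Rbar_lt (Finite x) rho -> exists r : R, (x < r)%R /\ Rbar_lt (Finite r) rho.
Proof.
  destruct rho as [s | |]; simpl; intros H.
  - exists ((x + s) / 2)%R. lra.
  - exists (x + 1)%R. split; [lra | exact I].
  - contradiction.
Qed.

Lemma RtoC_fact_neq_0 (n : nat) : RtoC (INR (fact n)) <> RtoC 0.
Proof. intros E. apply (INR_fact_neq_0 n). now injection E. Qed.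

(** The generating relation read as a power series with coefficients
    [F n / n!]. *)
Lemma is_bell_apostol_pseries (alpha : nat) (lambda eta delta x y : C)
    (F : nat -> C) (t : C) :
  is_bell_apostol alpha lambda eta delta x y F -> t <> RtoC 0 ->
  Rbar_lt (Finite (Cmod t)) (bell_apostol_radius lambda) ->
  is_seriesC (fun n => F n / RtoC (INR (fact n)) * t ^ n)
    (bell_apostol_gf alpha lambda eta delta x y t).
Proof.
  intros HF Ht Hlt. eapply is_series_ext; [| exact (HF t Ht Hlt)].
  intros n; simpl. field. apply RtoC_fact_neq_0.
Qed.

Lemma is_bell_apostol_unique (alpha : nat) (lambda eta delta x y : C)
    (F G : nat -> C) :
  is_bell_apostol alpha lambda eta delta x y F ->
  is_bell_apostol alpha lambda eta delta x y G ->
  forall n, F n = G n.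
Proof.
  intros HF HG n.
  destruct (Rbar_lt_dense _ _ (bell_apostol_radius_gt_0 lambda)) as [r [Hr Hlt]].
  assert (E : F n / RtoC (INR (fact n)) = G n / RtoC (INR (fact n))).
  { apply (pseriesC_coef_unique (fun n => F n / RtoC (INR (fact n)))
             (fun n => G n / RtoC (INR (fact n))) r Hr).
    intros u Hu. exists (bell_apostol_gf alpha lambda eta delta x y (RtoC u)).
    assert (Hu0 : RtoC u <> RtoC 0).
    { intros E. injection E as E. rewrite E, Rabs_R0 in Hu. lra. }
    assert (Hur : Rbar_lt (Finite (Cmod (RtoC u))) (bell_apostol_radius lambda)).
    { rewrite Cmod_R. apply Rbar_lt_trans with (Finite r); [simpl; lra | exact Hlt]. }
    split; now apply is_bell_apostol_pseries. }
  pose proof (RtoC_fact_neq_0 n) as Hn.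
  replace (F n) with (F n / RtoC (INR (fact n)) * RtoC (INR (fact n))) by now field.
  rewrite E. now field.
Qed.

Lemma is_bell_apostol_abs (alpha : nat) (lambda eta delta x y : C)
    (F : nat -> C) (t : C) :
  is_bell_apostol alpha lambda eta delta x y F ->
  Rbar_lt (Finite (Cmod t)) (bell_apostol_radius lambda) ->
  ex_series (fun n => Cmod (F n / RtoC (INR (fact n)) * t ^ n)).
Proof.
  intros HF Hlt. pose proof (Cmod_ge_0 t) as Ht0.
  destruct (Rbar_lt_dense _ _ Hlt) as [r [Htr Hr]].
  (* The generating relation at the real point r > |t| gives convergence there. *)
  apply ex_series_Cmod_inside with r
    (bell_apostol_gf alpha lambda eta delta x y (RtoC r)); [| exact Htr].
  apply is_bell_apostol_pseries; [exact HF | |].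
  - intros E. injection E as E. lra.
  - rewrite Cmod_R, Rabs_pos_eq by lra. exact Hr.
Qed.

(** The Cauchy product of the two expansions, with [1 / n!] factored out of each
    coefficient, is the expansion for order [alpha1 + alpha2]. *)
Lemma is_bell_apostol_convolution (alpha1 alpha2 : nat)
    (lambda eta delta x1 x2 y1 y2 : C) (F G : nat -> C) :
  is_bell_apostol alpha1 lambda eta delta x1 y1 F ->
  is_bell_apostol alpha2 lambda eta delta x2 y2 G ->
  is_bell_apostol (alpha1 + alpha2) lambda eta delta (x1 + x2) (y1 + y2)
    (fun n => sum_n (fun k => RtoC (Binomial.C n k) * F k * G (n - k)%nat) n).
Proof.
  intros HF HG t Ht Hlt. rewrite bell_apostol_gf_mult.
  eapply is_series_ext;
    [| apply is_seriesC_mult;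
       [ exact (is_bell_apostol_pseries _ _ _ _ _ _ F t HF Ht Hlt)
       | exact (is_bell_apostol_pseries _ _ _ _ _ _ G t HG Ht Hlt)
       | exact (is_bell_apostol_abs _ _ _ _ _ _ F t HF Hlt)
       | exact (is_bell_apostol_abs _ _ _ _ _ _ G t HG Hlt) ] ].
  intros n; cbv beta.
  (* Termwise, C(n,k) / n! = 1 / (k! (n-k)!) and t^n = t^k t^(n-k). *)
  refine (eq_trans _ (sum_n_mult_r (K := C_Ring) (t ^ n / RtoC (INR (fact n)))
    (fun k => RtoC (Binomial.C n k) * F k * G (n - k)%nat) n)).
  apply sum_n_ext_loc. intros k Hk. change (@mult C_Ring) with Cmult.
  match goal with |- ?u = ?v => change (@eq C u v) end.
  replace (t ^ n) with (t ^ k * t ^ (n - k))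
    by (rewrite <- Cpow_add_r; f_equal; lia).
  unfold Binomial.C.
  rewrite RtoC_div, RtoC_mult
    by (apply Rmult_integral_contrapositive; split; apply INR_fact_neq_0).
  field. repeat split; apply RtoC_fact_neq_0.
Qed.

(** The epsilon defining [bell_apostol] is a choice of coefficient sequence, and
    it is a correct one as soon as an expansion exists. *)
Lemma bell_apostol_spec (alpha : nat) (lambda eta delta x y : C) :
  ex_bell_apostol alpha lambda eta delta x y ->
  is_bell_apostol alpha lambda eta delta x y
    (fun n => bell_apostol alpha n x y lambda eta delta).
Proof. intros H. exact (epsilon_spec _ _ H). Qed.

Theorem theorem3p1 (alpha1 alpha2 : nat) (lambda eta delta : C)
    (x1 x2 y1 y2 : C) (n : nat) (n_gt0 : (1 <= n)%nat)
    (ex1 : ex_bell_apostol alpha1 lambda eta delta x1 y1)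
    (ex2 : ex_bell_apostol alpha2 lambda eta delta x2 y2) :
  bell_apostol (alpha1 + alpha2) n (x1 + x2) (y1 + y2) lambda eta delta =
  sum_n (fun k : nat =>
      RtoC (Binomial.C n k)
      * bell_apostol alpha1 k x1 y1 lambda eta delta
      * bell_apostol alpha2 (n - k) x2 y2 lambda eta delta) n.
Proof.
  pose proof (is_bell_apostol_convolution _ _ _ _ _ _ _ _ _ _ _
                (bell_apostol_spec _ _ _ _ _ _ ex1)
                (bell_apostol_spec _ _ _ _ _ _ ex2)) as Hconv.
  exact (is_bell_apostol_unique _ _ _ _ _ _ _ _
           (bell_apostol_spec _ _ _ _ _ _ (ex_intro _ _ Hconv)) Hconv n).
Qed.
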